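(* Let $S$ be a Seidel matrix of order $n\geqslant277$ with $\lambda_{\min}(S)=-5$. If the switching class $[S]$ contains a graph $G$ whose maximum valency $d_{\max}$ satisfies $d_{\max}\leqslant16$, then $\operatorname{rk}(S+5\mathbf{I})\geqslant\frac{2n}{3}+1$.
   Context: All graphs are finite, simple, undirected. A Seidel matrix of order $n$ is a real symmetric $n\times n$ matrix with zero diagonal and off-diagonal entries in $\{\pm1\}$; its graph $G(S)$ has vertex set $\{1,\dots,n\}$ with $i\sim j$ iff $S_{ij}=-1$. For $U\subseteq\{1,\dots,n\}$ let $D_U$ be the diagonal matrix with $(D_U)_{ii}=1$ if $i\in U$ and $-1$ otherwise. The switching class $[S]$ is the set of graphs $G(D_USD_U)$, $U\subseteq\{1,\dots,n\}$. $\lambda_{\min}$ is the smallest eigenvalue, $\operatorname{rk}$ the rank. *)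

(* Defs.v *)
From mathcomp Require Import all_boot all_order all_algebra.
From mathcomp Require Import reals.

Set Implicit Arguments.
Unset Strict Implicit.
Unset Printing Implicit Defensive.

Import Order.TTheory GRing.Theory Num.Theory.
Local Open Scope ring_scope.

Definition is_seidel (R : realType) (n : nat) (S : 'M[R]_n) : Prop :=
  [/\ S^T = S,
      forall i, S i i = 0
    & forall i j, i != j -> S i j = 1 \/ S i j = -1].

(* A finite simple graph on 'I_n is given by its adjacency relation; the
   adjacency relation of a Seidel matrix is symmetric and irreflexive
   (seidel_graph_sym, seidel_graph_irr below). *)
Definition seidel_graph (R : realType) (n : nat) (S : 'M[R]_n) : rel 'I_n :=
  fun i j => S i j == -1.

Definition switch_mx (R : realType) (n : nat) (U : {set 'I_n}) : 'M[R]_n :=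
  diag_mx (\row_i (if i \in U then 1 else -1)).

Definition switching (R : realType) (n : nat) (U : {set 'I_n}) (S : 'M[R]_n)
  : 'M[R]_n := switch_mx R U *m S *m switch_mx R U.

(* Graphs are compared extensionally, by =2 on their adjacency relations. *)
Definition switching_class (R : realType) (n : nat) (S : 'M[R]_n)
    (G : rel 'I_n) : Prop :=
  exists U : {set 'I_n}, G =2 seidel_graph (switching U S).

Definition valency (n : nat) (G : rel 'I_n) (i : 'I_n) : nat :=
  #|[set j | G i j]|.

Definition max_valency (n : nat) (G : rel 'I_n) : nat :=
  (\max_(i < n) valency G i)%N.

(* For a symmetric S all complex eigenvalues are real, and row and column
   eigenvectors agree, so [eigenvalue] over R is the whole spectrum. *)
Definition is_lambda_min (R : realType) (n : nat) (S : 'M[R]_n) (a : R)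
  : Prop :=
  eigenvalue S a /\ forall b : R, eigenvalue S b -> a <= b.

Lemma seidel_graph_sym (R : realType) (n : nat) (S : 'M[R]_n) :
  is_seidel S -> symmetric (seidel_graph S).
Proof. by case=> St _ _ i j; rewrite /seidel_graph -{1}St mxE. Qed.

Lemma seidel_graph_irr (R : realType) (n : nat) (S : 'M[R]_n) :
  is_seidel S -> irreflexive (seidel_graph S).
Proof.
by case=> _ S0 _ i; rewrite /seidel_graph S0 eq_sym oppr_eq0 oner_eq0.
Qed.

Lemma switchingE (R : realType) (n : nat) (U : {set 'I_n}) (S : 'M[R]_n) i j :
  switching U S i j =
    (if i \in U then 1 else -1) * S i j * (if j \in U then 1 else -1).
Proof. by rewrite /switching mul_mx_diag mul_diag_mx !mxE. Qed.

Lemma switching_seidel (R : realType) (n : nat) (U : {set 'I_n})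
    (S : 'M[R]_n) :
  is_seidel S -> is_seidel (switching U S).
Proof.
case=> St S0 S1; split=> [|i|i j /S1 Sij]; last 2 first.
- by rewrite switchingE S0 mulr0 mul0r.
- by rewrite switchingE; case: Sij => ->; do 2 case: ifP => _;
  rewrite ?(mulr1, mul1r, mulrN, mulNr, opprK); auto.
by apply/matrixP=> i j; rewrite mxE !switchingE -{1}St mxE mulrC mulrA mulrAC.
Qed.

(* Main.v *)
(* With [A] the adjacency matrix of [G], the switched matrix plus 5 I is
   J - 2 (A - 2 I), so q(x) = x^T (A - 2 I) x satisfies 2 q(x) <= (sum x)^2, and
   the claim is that the kernel K has dimension at most n/3 - 1.
   - If q(v) > 0, then q is negative on the nonnegative nonzero vectors that
     vanish on the closed neighbourhood N of supp v; hence a vector of K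
     vanishing on N is zero and dim K <= |N|.  This suffices if |N| <= 91.
   - A vertex of degree at least 5 gives such a v, and testing q on the indicator
     function of the complement of N yields n <= 276.
   - If all degrees are at most 4 and no v as above has |N| <= 91, then each
     component has at most 46 vertices or looks locally like a Dynkin diagram of
     type A, A~, D or D~; either way q <= 0 on it.
   - If q <= 0 everywhere, K consists of the eigenvectors of A for the value 2
     with zero sum.  Such an eigenvector has constant sign on each component and
     vanishes on components with fewer than 3 vertices, so K embeds into the
     functions on all but one of the at most n/3 larger components. *)
Require Import Defs.
From mathcomp Require Import all_boot all_order all_algebra.
From mathcomp Require Import reals.
From mathcomp Require Import boolp complex.
From mathcomp Require Import ring lra zify.

Set Implicit Arguments.
Unset Strict Implicit.
Unset Printing Implicit Defensive.

Import Order.TTheory GRing.Theory Num.Theory.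
Local Open Scope ring_scope.

(** * Linear algebra: the Rayleigh bound and a bound for the rank *)

(** Over the complex numbers [A] is unitarily diagonalisable with real eigenvalues, which are then
    eigenvalues over [R]. In eigencoordinates both sides are sums of squared moduli, weighted by [a]
    and by the eigenvalues. *)
Lemma symmetric_rayleigh (R : rcfType) (n : nat) (A : 'M[R]_n) (a : R) :
  A^T = A -> (forall b, eigenvalue A b -> a <= b) ->
  forall x : 'rV[R]_n, a * (x *m x^T) 0 0 <= (x *m A *m x^T) 0 0.
Proof.
move=> At Aa x.
pose f := real_complex R.
pose C := map_mx f A.
have Creal : C \is a mxOver Num.real.
  by apply/mxOverP => i j; rewrite mxE; apply/complex_realP; exists (A i j).
have Csym : C \is symmetricmx.
  apply/is_hermitianmxP; rewrite expr0 scale1r map_mx_id //.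
  by rewrite /C map_trmx At.
have Cherm := realsym_hermsym Csym Creal.
have /orthomx_spectralP := hermitian_normalmx Cherm.
have := hermitian_spectral_diag_real Cherm.
set P := spectralmx C; set d := spectral_diag C => dreal CE.
have Pu : P \is unitarymx := spectral_unitarymx C.
have PE : invmx P = map_mx Num.conj P^T := invmx_unitary Pu.
have PC : P *m C = diag_mx d *m P.
  by rewrite {1}CE !mulmxA mulmxV ?mul1mx // unitarymx_unit.
have dge i : f a <= d 0 i.
  have /complex_realP[r dr] := mxOverP dreal 0 i.
  rewrite dr lecR; apply: Aa.
  rewrite -(eigenvalue_map f); apply/eigenvalueP; exists (row i P).
    rewrite -row_mul PC mul_diag_mx; apply/rowP => j.
    by rewrite !mxE dr.
  apply/eqP => P0; have /rowP/(_ i) : row i (P *m invmx P) = 0.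
    by rewrite row_mul P0 mul0mx.
  by rewrite mulmxV ?unitarymx_unit // !mxE eqxx => /eqP; rewrite oner_eq0.
pose y := map_mx f x; pose w := y *m invmx P.
have yC : map_mx Num.conj y = y.
  apply/matrixP => i j; rewrite !mxE conj_Creal //.
  by apply/complex_realP; exists (x i j).
have wT : map_mx Num.conj w^T = P *m y^T.
  rewrite /w PE trmx_mul map_mxM -[in RHS]yC map_trmx; congr (_ *m _).
    by apply/matrixP=> i j; rewrite !mxE; exact: conjCK.
  by apply/matrixP=> i j; rewrite !mxE.
have yy : y *m y^T = w *m map_mx Num.conj w^T.
  by rewrite wT /w mulmxA mulmxKV ?unitarymx_unit.
have yCy : y *m C *m y^T = w *m diag_mx d *m map_mx Num.conj w^T.
  by rewrite wT /w CE !mulmxA.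
rewrite -lecR rmorphM /=.
have -> : (((x *m x^T) 0 0)%:C)%C = (y *m y^T) 0 0.
  by rewrite /y map_trmx -map_mxM [RHS]mxE.
have -> : (((x *m A *m x^T) 0 0)%:C)%C = (y *m C *m y^T) 0 0.
  by rewrite /y /C map_trmx -!map_mxM [RHS]mxE.
rewrite yy yCy; clear wT yy yCy; clearbody w.
rewrite mul_mx_diag !mxE mulr_sumr ler_sum // => i _.
set u := w 0 i; have -> : (map_mx Num.conj w^T) i 0 = u^* by rewrite !mxE.
have -> : (\matrix_(i, j) (w i j * d 0 j)) 0 i = u * d 0 i by rewrite mxE.
rewrite [u * d 0 i]mulrC -[leRHS]mulrA; apply: ler_wpM2r; last exact: dge.
exact: mul_conjC_ge0.
Qed.

(** Appending to [M] the columns of the identity indexed by [B] leaves no left kernel, so the rank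
    becomes [n]; each new column raises it by at most one. *)
Lemma rank_complement_bound (F : fieldType) (n : nat) (M : 'M[F]_n)
    (B : {set 'I_n}) :
  (forall x : 'rV_n, x *m M = 0 -> (forall i, i \in B -> x 0 i = 0) -> x = 0) ->
  (n <= \rank M + #|B|)%N.
Proof.
move=> MB0.
pose P : 'M[F]_(n, #|B|) := \matrix_(i, k) (i == enum_val k)%:R.
have free : row_free (row_mx M P).
  rewrite -kermx_eq0; apply/eqP/row_matrixP => i; rewrite row0.
  have : row i (kermx (row_mx M P)) *m row_mx M P = 0.
    by rewrite -row_mul mulmx_ker row0.
  move: (row i _) => x.
  rewrite mul_mx_row -(row_mx0 _ 1 n #|B|) => /eq_row_mx[xM xP].
  apply: MB0 => // j jB.
  have /rowP/(_ (enum_rank_in jB j)) := xP.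
  rewrite [LHS]mxE [RHS]mxE (bigD1 j) //= mxE enum_rankK_in // eqxx mulr1.
  rewrite big1 ?addr0 // => k kj.
  by rewrite mxE enum_rankK_in // (negPf kj) mulr0.
rewrite -{1}(eqP free) -mxrank_tr tr_row_mx.
rewrite -addsmxE (leq_trans (mxrank_adds_leqif _ _)) //.
by rewrite !mxrank_tr leq_add2l rank_leq_col.
Qed.

(** * The quadratic form of a graph *)

Section GraphForm.

Variables (R : realFieldType) (T : finType) (G : rel T).
Hypotheses (Gsym : symmetric G) (Girr : irreflexive G).

Implicit Types (x y v w f : T -> R) (F : {set T}) (i j u : T).

Definition nsum x i : R := \sum_(j | G i j) x j.

Definition pform x y : R := \sum_i x i * (nsum y i - 2 * y i).

(* The quadratic form of [A - 2 I], with [A] the adjacency matrix of [G]. *)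
Definition qform x : R := pform x x.

Definition psupp x : {set T} := [set i | x i != 0].

Definition nbhd F : {set T} := [set i | (i \in F) || [exists j in F, G j i]].

Definition degree i : nat := #|[set j | G i j]|.

Definition component i : {set T} := [set j | fingraph.root G j == fingraph.root G i].

Lemma nsumD x y i : nsum (fun k => x k + y k) i = nsum x i + nsum y i.
Proof. exact: big_split. Qed.

Lemma nsumZ a x i : nsum (fun k => a * x k) i = a * nsum x i.
Proof. by rewrite /nsum mulr_sumr. Qed.

Lemma nsumN x i : nsum (fun k => - x k) i = - nsum x i.
Proof. by rewrite /nsum sumrN. Qed.

Lemma nsum_const a i : nsum (fun=> a) i = a * (degree i)%:R.
Proof. by rewrite /nsum sumr_const /degree cardsE mulr_natr. Qed.

Lemma ler_nsum x y i :
  (forall j, G i j -> x j <= y j) -> nsum x i <= nsum y i.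
Proof. exact: ler_sum. Qed.

Lemma nsum_ge0 x i : (forall j, 0 <= x j) -> 0 <= nsum x i.
Proof. by move=> x0; exact: sumr_ge0. Qed.

Lemma ler_nsum1 x i j : (forall k, 0 <= x k) -> G i j -> x j <= nsum x i.
Proof.
by move=> x0 ij; rewrite /nsum (bigD1 j) //= lerDl sumr_ge0.
Qed.

Lemma pformC x y : pform x y = pform y x.
Proof.
rewrite /pform; under eq_bigr do rewrite mulrBr.
under [RHS]eq_bigr do rewrite mulrBr.
rewrite !sumrB; congr (_ - _); last by apply: eq_bigr => i _; ring.
rewrite /nsum; under eq_bigr do rewrite mulr_sumr.
under [RHS]eq_bigr do rewrite mulr_sumr.
rewrite (exchange_big_dep predT) //=; apply: eq_bigr => j _.
by apply: eq_big => [i|i _]; [rewrite Gsym | rewrite mulrC].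
Qed.

Lemma qform_comb a x b y :
  qform (fun i => a * x i + b * y i) =
  a ^+ 2 * qform x + 2 * a * b * pform x y + b ^+ 2 * qform y.
Proof.
have -> : 2 * a * b * pform x y = a * b * pform x y + a * b * pform y x.
  by rewrite (pformC y x); ring.
rewrite /qform /pform !mulr_sumr -!big_split; apply: eq_bigr => i _ /=.
by rewrite nsumD !nsumZ; ring.
Qed.

Lemma qform_norm x : qform x <= qform (fun i => `|x i|).
Proof.
apply: ler_sum => i _; rewrite !mulrBr.
have -> : `|x i| * (2 * `|x i|) = x i * (2 * x i).
  by rewrite mulrCA -normrM ger0_norm ?sqr_ge0 //; ring.
rewrite lerD2r (le_trans (ler_norm _)) // normrM ler_wpM2l ?normr_ge0 //.
exact: ler_norm_sum.
Qed.

Lemma qform_ge_diag x : (forall i, 0 <= x i) ->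
  - 2 * \sum_i x i ^+ 2 <= qform x.
Proof.
move=> x0; rewrite mulr_sumr; apply: ler_sum => i _.
have := mulr_ge0 (x0 i) (nsum_ge0 i x0); lra.
Qed.

Lemma qform_eigen x : (forall i, nsum x i = 2 * x i) -> qform x = 0.
Proof. by move=> ex; apply: big1 => i _; rewrite ex subrr mulr0. Qed.

(** No edge joins the support of [v] to a vertex outside its closed neighbourhood. *)
Lemma pform_sep v w : (forall i, i \in nbhd (psupp v) -> w i = 0) ->
  pform v w = 0.
Proof.
move=> w0; rewrite pformC; apply: big1 => i _.
have [/w0->|] := boolP (i \in nbhd (psupp v)); first by rewrite mul0r.
rewrite inE negb_or inE negbK => /andP[/eqP-> vi].
rewrite mulr0 subr0 /nsum big1 ?mulr0 // => j ij.
apply/eqP; apply: contraR vi => vj; apply/existsP; exists j.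
by rewrite inE vj Gsym.
Qed.

Lemma pform_delta j y : pform (fun k => (k == j)%:R) y = nsum y j - 2 * y j.
Proof.
rewrite /pform (bigD1 j) //= eqxx mul1r big1 ?addr0 // => i /negPf->.
by rewrite mul0r.
Qed.

Lemma qform_delta j : qform (fun k => (k == j)%:R) = - 2.
Proof.
rewrite /qform pform_delta eqxx /nsum big1 ?mulr1 ?sub0r // => i.
by case: eqP => // ->; rewrite Girr.
Qed.

(* Adding a small multiple of a boundary vertex [j] to [f] increases the form
   to first order, and only costs to second order. *)
Lemma qform_extend f i j : (forall k, 0 <= f k) -> 0 <= qform f ->
  i \in psupp f -> j \notin psupp f -> G i j ->
  exists2 v, forall k, 0 <= v k &
    0 < qform v /\ psupp v \subset j |: psupp f.
Proof.
rewrite !inE negbK => f0 qf fi /eqP fj ij.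
have fi0 : 0 < f i by rewrite lt_def fi f0.
(* With coefficient [f i / 2] the cross term gains at least [f i ^+ 2], and the term at [j] costs
   half of that. *)
exists (fun k => 1 * f k + f i / 2 * (k == j)%:R).
  by move=> k; rewrite mul1r addr_ge0 ?mulr_ge0 ?invr_ge0 ?ler0n.
split; last first.
  apply/subsetP => k; rewrite !inE; case: (k =P j) => //= _.
  by rewrite mulr0 addr0 mul1r.
rewrite qform_comb pformC pform_delta qform_delta fj.
have /ler_nsum1 : forall k, 0 <= f k by [].
move=> /(_ j i); rewrite Gsym => /(_ ij) h.
have := mulr_ge0 (ltW fi0) (ltW fi0).
have : 0 < f i * f i by exact: mulr_gt0.
have : f i * f i <= f i * nsum f j by rewrite ler_pM2l.
nra.
Qed.

(** On each edge, 2 x_i x_j is at most x_i^2 f_j / f_i + x_j^2 f_i / f_j, the difference being a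
    square over f_i f_j. Summed over the edges, the coefficient of x_i^2 is [nsum f i / f i], at
    most 2 wherever x_i is nonzero. *)
Lemma qform_superharmonic f x :
  (forall i, 0 < f i) -> (forall i, x i != 0 -> nsum f i <= 2 * f i) ->
  qform x <= 0.
Proof.
move=> f0 fs.
have fV i : f i * (f i)^-1 = 1 by rewrite mulfV // gt_eqF.
have half : \sum_i x i * nsum x i <=
    \sum_i \sum_(j | G i j) (x i ^+ 2 * f j / f i).
  have dbl : \sum_i \sum_(j | G i j) x i ^+ 2 * f j / f i =
      \sum_i \sum_(j | G i j) x j ^+ 2 * f i / f j.
    rewrite (exchange_big_dep predT) //=; apply: eq_bigr => j _.
    by apply: eq_bigl => i; rewrite Gsym.
  rewrite -(ler_pM2l (ltr0Sn R 1)) [leRHS]mulr_natl [leRHS]mulr2n {2}dbl -big_split /=.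
  rewrite mulr_sumr; apply: ler_sum => i _.
  rewrite -big_split /= /nsum !mulr_sumr; apply: ler_sum => j _.
  have := f0 i; have := f0 j; rewrite -subr_ge0 => fj fi.
  have -> : x i ^+ 2 * f j / f i + x j ^+ 2 * f i / f j - 2 * (x i * x j) =
      (x i * f j - x j * f i) ^+ 2 / (f i * f j).
    by field; rewrite !gt_eqF.
  by rewrite divr_ge0 ?sqr_ge0 ?mulr_ge0 ?ltW.
rewrite /qform /pform; under eq_bigr do rewrite mulrBr.
rewrite sumrB subr_le0 (le_trans half) //; apply: ler_sum => i _.
have -> : \sum_(j | G i j) x i ^+ 2 * f j / f i = x i ^+ 2 * (nsum f i / f i).
  by rewrite /nsum mulr_suml mulr_sumr; apply: eq_bigr => j _; rewrite mulrA.
have [->|xi] := eqVneq (x i) 0; first by rewrite expr0n !mul0r.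
have -> : x i * (2 * x i) = x i ^+ 2 * 2 by ring.
by rewrite ler_wpM2l ?sqr_ge0 // ler_pdivrMr ?fs.
Qed.

Definition star u a : T -> R := fun i => if i == u then a else (G u i)%:R.

(** Only edges at [u] are counted; those between neighbours of [u] can only increase the form. *)
Lemma qform_star u a : 0 <= a ->
  2 * (a - 1) * (degree u)%:R - 2 * a ^+ 2 <= qform (star u a).
Proof.
move=> a0; have s0 k : 0 <= star u a k by rewrite /star; case: eqP => // _; rewrite ler0n.
have su : nsum (star u a) u = (degree u)%:R.
  rewrite -[RHS]mul1r -nsum_const; apply: eq_bigr => j uj.
  by rewrite /star uj; case: eqP => // ju; rewrite ju Girr in uj.
rewrite /qform /pform (bigD1 u) //= su {1 2}/star eqxx.
have : \sum_(i | G u i) (a - 2) <=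
    \sum_(i | i != u) star u a i * (nsum (star u a) i - 2 * star u a i).
  rewrite [leRHS](bigID (G u)) /= [X in _ <= _ + X]big1 ?addr0; last first.
    by move=> i /andP[iu ui]; rewrite /star (negPf iu) (negPf ui) mul0r.
  rewrite [leRHS](eq_bigl (G u)); last first.
    by move=> i; case: eqP => // ->; rewrite Girr.
  apply: ler_sum => i ui; have iu : i != u by apply: contraTneq ui => ->; rewrite Girr.
  rewrite [star u a i]/star (negPf iu) ui mul1r mulr1 lerD2r.
  rewrite Gsym in ui; have := ler_nsum1 s0 ui.
  by rewrite {1}/star eqxx.
have -> : \sum_(i | G u i) (a - 2) = (a - 2) * (degree u)%:R.
  by rewrite sumr_const /degree cardsE mulr_natr.
by set q := \sum_(i | _) _; lra.
Qed.

Lemma psupp_star u a : psupp (star u a) \subset u |: [set j | G u j].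
Proof.
apply/subsetP => i; rewrite !inE /star; case: (i =P u) => // _.
by case: (G u i); rewrite ?eqxx.
Qed.

Lemma sum_star u a : \sum_i star u a i = a + (degree u)%:R.
Proof.
rewrite (bigD1 u) //= {1}/star eqxx; congr (_ + _).
rewrite (eq_bigr (fun i => (G u i)%:R)) => [|i /negPf iu]; last by rewrite /star iu.
rewrite /degree cardsE -sum1_card natr_sum big_mkcond [RHS]big_mkcond.
apply: eq_bigr => i _; rewrite unfold_in; case: (i =P u) => [->|_]; first by rewrite Girr.
by case: (G u i).
Qed.

(** * Closed neighbourhoods and their sizes *)

Lemma sub_nbhd F : F \subset nbhd F.
Proof. by apply/subsetP => i iF; rewrite inE iF. Qed.

Lemma mem_nbhd F i j : i \in F -> G i j -> j \in nbhd F.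
Proof.
move=> iF ij; rewrite inE orbC; apply/orP; left.
by apply/existsP; exists i; rewrite iF.
Qed.

Lemma nbhdP F j : reflect (j \in F \/ exists2 i, i \in F & G i j) (j \in nbhd F).
Proof.
apply: (iffP idP) => [|[jF|[i iF ij]]]; last exact: mem_nbhd ij.
  rewrite inE => /orP[|/existsP[i /andP[iF ij]]]; first by left.
  by right; exists i.
exact: (subsetP (sub_nbhd F)).
Qed.

Lemma nbhdS F F' : F \subset F' -> nbhd F \subset nbhd F'.
Proof.
move=> /subsetP sF; apply/subsetP => j /nbhdP[/sF jF|[i /sF iF ij]].
  exact: (subsetP (sub_nbhd F')).
exact: mem_nbhd ij.
Qed.

Lemma card_bigcup_le (I : finType) (A : {set I}) (P : I -> {set T}) (c : nat) :
  (forall k : I, k \in A -> #|P k| <= c)%N -> (#|\bigcup_(k in A) P k| <= #|A| * c)%N.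
Proof.
move=> Pc; rewrite -sum_nat_const.
apply: (@leq_trans (\sum_(k in A) #|P k|)); last exact: leq_sum.
elim/big_rec2: _ => [|k y X _ IH]; first by rewrite cards0.
by rewrite (leq_trans (leq_card_setU _ _).1) // leq_add2l.
Qed.

Lemma card_nbhd F c : (forall i, degree i <= c)%N -> (#|nbhd F| <= #|F| * c.+1)%N.
Proof.
move=> dc; apply: (leq_trans (n := #|\bigcup_(i in F) (i |: [set j | G i j])|)).
  apply/subset_leq_card/subsetP => j /nbhdP[jF|[i iF ij]].
    by apply/bigcupP; exists j; rewrite ?setU11.
  by apply/bigcupP; exists i; rewrite // !inE ij orbT.
apply: card_bigcup_le => i _; rewrite cardsU1.
by rewrite (leq_add (leq_b1 _) (dc i)).
Qed.

(** The centre is counted once: a neighbour [j] adds, besides [u], at most [degree j] vertices,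
    itself included. *)
Lemma card_nbhd_star u c : (0 < degree u)%N -> (forall i, degree i <= c)%N ->
  (#|nbhd (u |: [set j | G u j])| <= 1 + degree u * c)%N.
Proof.
move=> d0 dc.
apply: (leq_trans (n :=
  #|u |: \bigcup_(j in [set j | G u j]) ((j |: [set k | G j k]) :\ u)|)).
  apply/subset_leq_card/subsetP => k.
  rewrite in_setU1; case: (k =P u) => //= /eqP ku.
  case/nbhdP => [|[j]]; rewrite !inE ?(negPf ku) /=.
    by move=> uk; apply/bigcupP; exists k; rewrite !inE ?ku ?eqxx.
  case/orP => [/eqP-> uk|uj jk]; first by apply/bigcupP; exists k; rewrite !inE ?ku ?eqxx.
  by apply/bigcupP; exists j; rewrite !inE ?ku ?jk ?orbT.
rewrite cardsU1 leq_add ?leq_b1 // card_bigcup_le // => j; rewrite inE => uj.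
have ju : j != u by apply: contraTneq uj => ->; rewrite Girr.
have := cardsD1 u (j |: [set k | G j k]).
rewrite !inE [G j u]Gsym uj orbT cardsU1 inE Girr /= !add1n => -[<-].
exact: dc.
Qed.

(** * Consequences of positive semidefiniteness *)

Section Psd.

Hypothesis psd : forall x, 2 * qform x <= (\sum_i x i) ^+ 2.

(* Apply [psd] to the combination of [v] and [w] with zero sum. *)
Lemma qform_sep v w : (forall i, i \in nbhd (psupp v) -> w i = 0) ->
  (\sum_i w i) ^+ 2 * qform v + (\sum_i v i) ^+ 2 * qform w <= 0.
Proof.
move=> /pform_sep vw; set sv := \sum_i v i; set sw := \sum_i w i.
have := psd (fun i => sw * v i + - sv * w i).
rewrite qform_comb vw mulr0 addr0 big_split /= -!mulr_sumr -/sv -/sw.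
nra.
Qed.

(** Entry by entry, this says that J - 2 (A - 2 I) annihilates [x]. *)
Definition in_kernel x := forall i, 2 * (nsum x i - 2 * x i) = \sum_j x j.

Lemma qform_kernel x : in_kernel x -> 2 * qform x = (\sum_i x i) ^+ 2.
Proof.
move=> Kx; rewrite expr2 {1}mulr_suml /qform /pform mulr_sumr.
by apply: eq_bigr => i _; rewrite -(Kx i); ring.
Qed.

Lemma norm_sum0 x : \sum_i `|x i| = 0 -> forall i, x i = 0.
Proof.
move=> /eqP; rewrite psumr_eq0 // => /allP x0 i.
by apply/eqP; rewrite -normr_eq0; apply: x0; rewrite mem_index_enum.
Qed.

(** Two uses of [qform_sep]: on [x], where twice the form is a square, and on its absolute value,
    whose form is no smaller and hence nonnegative. The latter forces the sum of absolute values to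
    vanish. *)
Lemma kernel_unique v x : 0 < qform v -> in_kernel x ->
  (forall i, i \in nbhd (psupp v) -> x i = 0) -> forall i, x i = 0.
Proof.
move=> qv Kx x0; apply: norm_sum0.
have qx := qform_kernel Kx; have := qform_sep x0.
have /qform_sep : forall i, i \in nbhd (psupp v) -> `|x i| = 0.
  by move=> i /x0->; rewrite normr0.
have := qform_norm x.
set s := \sum_i x i in qx *; set sv := \sum_i v i; set s' := \sum_i `|x i|.
set q := qform x in qx *; set q' := qform _.
move=> qq' h' h.
have s2 := sqr_ge0 s; have sv2 := sqr_ge0 sv.
have s'2 := sqr_ge0 s'.
have q'0 : 0 <= q' by lra.
have : s' ^+ 2 * qform v <= 0 by have := mulr_ge0 sv2 q'0; lra.
rewrite pmulr_lle0 // => s'0.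
by apply/eqP; rewrite -sqrf_eq0 eq_le s'0 s'2.
Qed.

(* The star at [u] with weight 3 at its centre has a closed neighbourhood of at most 257
   vertices, and by [qform_sep] the set of the others cannot be large. *)
Lemma degree_large_bound u : (forall i, degree i <= 16)%N -> (5 <= degree u)%N ->
  (#|T| <= 276)%N.
Proof.
move=> d16 d5; pose v := star u 3.
have svS : psupp v \subset u |: [set j | G u j] := psupp_star u 3.
have := card_nbhd_star (ltnW (ltnW (ltnW (ltnW d5)))) d16.
have /subset_leq_card := nbhdS svS.
set B := nbhd (psupp v) => h1 h2; have {h1 h2} Bc := leq_trans h1 h2.
have := qform_star u (ler0n R 3); rewrite -/v.
pose w i : R := (i \notin B)%:R.
have /qform_sep : forall i, i \in nbhd (psupp v) -> w i = 0 by move=> i iB; rewrite /w iB.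
have := @qform_ge_diag w (fun i => ler0n _ _).
have sw : \sum_i w i = #|~: B|%:R.
  rewrite -sum1_card natr_sum [RHS]big_mkcond /=; apply: eq_bigr => i _.
  by rewrite /w in_setC; case: (i \in B).
have -> : \sum_i w i ^+ 2 = #|~: B|%:R.
  rewrite -sw; apply: eq_bigr => i _; rewrite /w.
  by case: (i \in B) => /=; rewrite ?expr1n ?expr0n.
rewrite sw sum_star -(cardsC B).
set W := #|~: B|; set qw := qform w; set qv := qform v; have := d16 u.
move: (degree u) d5 Bc => d d5 Bc d16' q1 q2 q3.
rewrite leqNgt; apply/negP => Bw.
have W0 : (0 < W)%N by lia.
(* The form is at least 4d - 18 at [v] and at least -2W at [w], with sums d + 3 and W; divide
   [qform_sep] by 2W. *)
have : (W * (2 * d - 9) <= (d + 3) ^ 2)%N.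
  rewrite -(ler_nat R) natrM natrB ?natrX ?natrD ?natrM; last lia.
  have W0' : (0 : R) < W%:R by rewrite ltr0n.
  rewrite -(ler_pM2l W0').
  have : W%:R ^+ 2 * (4 * d%:R - 18) <= W%:R ^+ 2 * qv.
    by rewrite ler_wpM2l ?sqr_ge0 //; lra.
  have : (3 + d%:R) ^+ 2 * (- 2 * W%:R) <= (3 + d%:R) ^+ 2 * qw :> R.
    by rewrite ler_wpM2l ?sqr_ge0.
  lra.
(* [B] has at most 1 + 16d of the more than 276 vertices. This lower bound on W contradicts the
   upper one for each d from 5 to 16. *)
have : (276 - 16 * d <= W)%N by lia.
have : d \in iota 5 12 by rewrite mem_iota; lia.
move=> + Wd Wb; rewrite !inE.
by do 11?[case/orP]; move=> /eqP dE; rewrite dE in Wd Wb; lia.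
Qed.

End Psd.

(** * Components, spheres and weights pushed forward from E8~ *)

Lemma connect_G_sym : connect_sym G.
Proof. exact: sym_connect_sym. Qed.

Lemma mem_component i j : (j \in component i) = connect G j i.
Proof. by rewrite inE root_connect //; exact: connect_G_sym. Qed.

Lemma component_id i : i \in component i.
Proof. by rewrite inE. Qed.

Lemma component_nbr i j k : G j k -> (j \in component i) = (k \in component i).
Proof.
move=> jk; rewrite !mem_component; apply: same_connect; first exact: connect_G_sym.
exact: connect1.
Qed.

Lemma component_eq i j : j \in component i -> component j = component i.
Proof. by rewrite inE => /eqP ji; apply/setP => k; rewrite !inE ji. Qed.

Definition gclosed F := forall i j, i \in F -> G i j -> j \in F.

Lemma component_sub F i : gclosed F -> i \in F -> component i \subset F.
Proof.
move=> Fc iF; apply/subsetP => j; rewrite mem_component connect_G_sym => ij.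
have cl : closed G (mem F).
  by apply: (intro_closed connect_G_sym) => a b ab aF; exact: Fc ab.
by rewrite -(closed_connect cl ij).
Qed.

Lemma nbhd_closed F : gclosed F -> nbhd F = F.
Proof.
move=> Fc; apply/eqP; rewrite eqEsubset sub_nbhd andbT; apply/subsetP => j.
by case/nbhdP => // -[i iF ij]; exact: Fc ij.
Qed.

Lemma component_closed i : gclosed (component i).
Proof. by move=> j k jC jk; rewrite -(component_nbr i jk). Qed.

Definition restr F x : T -> R := fun i => if i \in F then x i else 0.

Lemma qform_restr F x : gclosed F ->
  qform (restr F x) = \sum_(i in F) x i * (nsum x i - 2 * x i).
Proof.
move=> Fc; rewrite [RHS]big_mkcond; apply: eq_bigr => i _; rewrite /restr.
case: ifP => iF; last by rewrite mul0r.
congr (_ * (_ - _)); apply: eq_bigr => j ij.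
by rewrite (Fc _ _ iF ij).
Qed.

Lemma qform_components x :
  (forall i, qform (restr (component i) x) <= 0) -> qform x <= 0.
Proof.
move=> xC; rewrite /qform /pform (partition_big (fingraph.root G) predT) //=.
apply: sumr_le0 => r _.
have [/existsP[i /eqP ir]|] := boolP [exists i, fingraph.root G i == r].
  rewrite (eq_bigl (fun j => j \in component i)) => [|j]; last by rewrite inE ir.
  by rewrite -qform_restr //; exact: component_closed.
rewrite negb_exists => /forallP nr.
by rewrite big1 // => i ir; rewrite (negPf (nr i)) in ir.
Qed.

Lemma card_set_degree2 i (X : {set T}) c :
  (degree i <= c.+1)%N -> (exists2 j, j \in X & G i j) ->
  (#|[set j | G i j] :\: X| <= c)%N.
Proof.
move=> dc [j jX ij]; rewrite -ltnS (leq_trans _ dc) //.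
apply: proper_card; rewrite properE subsetDl; apply/subsetPn; exists j.
  by rewrite inE.
by rewrite in_setD jX.
Qed.

(* Every vertex of the sphere [nbhd X :\: X] spends one of its at most [c.+1]
   edges on [X]. *)
Lemma card_next_sphere X c : (forall i, i \in nbhd X -> degree i <= c.+1)%N ->
  (#|nbhd (nbhd X) :\: nbhd X| <= #|nbhd X :\: X| * c)%N.
Proof.
move=> dc; apply: (leq_trans (n :=
  #|\bigcup_(i in nbhd X :\: X) ([set j | G i j] :\: X)|)).
  apply/subset_leq_card/subsetP => k; rewrite in_setD => /andP[kX].
  case/nbhdP => [/(negP kX)//|[j jX jk]].
  have njX : j \notin X by apply: contra kX => jX'; exact: mem_nbhd jk.
  apply/bigcupP; exists j; first by rewrite in_setD njX.
  rewrite !inE jk andbT; apply: contra kX; exact: (subsetP (sub_nbhd X)).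
apply: card_bigcup_le => j; rewrite in_setD => /andP[jX jN].
apply: card_set_degree2; first exact: dc.
case/nbhdP: jN => [/(negP jX)//|[i iX ij]]; by exists i; rewrite // Gsym.
Qed.

(* Spreads [v] along a walk homomorphism [phi] of an auxiliary graph [E] which
   is injective on neighbourhoods, as for a walk in the universal cover. *)
Section Pushforward.

Variables (I : finType) (E : rel I) (phi : I -> T) (v : I -> R).
Hypotheses (Esym : symmetric E) (v0 : forall s, 0 <= v s).
Hypothesis phi_hom : forall s t, E s t -> G (phi s) (phi t).
Hypothesis phi_locinj : forall s t t', E s t -> E s t' -> phi t = phi t' -> t = t'.
Hypothesis v_sub : forall s, 2 * v s <= \sum_(t | E s t) v t.

Definition push i : R := \sum_(s | phi s == i) v s.

Lemma push_ge0 i : 0 <= push i.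
Proof. exact: sumr_ge0. Qed.

Lemma psupp_push : psupp push \subset [set phi s | s in I].
Proof.
apply/subsetP => i; rewrite inE; apply: contraR => iI.
rewrite /push big1 // => s /eqP si; case/negP: iI.
by rewrite -si; apply/imsetP; exists s.
Qed.

Lemma card_psupp_push : (#|psupp push| <= #|I|)%N.
Proof. exact: leq_trans (subset_leq_card psupp_push) (leq_imset_card _ _). Qed.

Lemma push_gt0 s : 0 < v s -> 0 < push (phi s).
Proof.
move=> vs; rewrite /push (bigD1 s) //= ltr_wpDr // sumr_ge0 //.
Qed.

(** By local injectivity, each [t] over a neighbour of [i] has at most one [E]-neighbour over [i],
    so exchanging the sums counts [v t] at most once. *)
Lemma push_sub i : 2 * push i <= nsum push i.
Proof.
have -> : nsum push i = \sum_(t | G i (phi t)) v t.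
  rewrite /nsum /push (exchange_big_dep (fun t => G i (phi t))) /=; last first.
    by move=> j t ij /eqP->.
  apply: eq_bigr => t it; rewrite (big_pred1 (phi t)) // => j.
  by rewrite /= eq_sym; case: eqP => [->|]; rewrite ?it ?andbF.
apply: (@le_trans _ _ (\sum_(s | phi s == i) \sum_(t | E s t) v t)).
  by rewrite mulr_sumr; apply: ler_sum.
rewrite (exchange_big_dep (fun t => G i (phi t))) /=; last first.
  by move=> s t /eqP<- st; exact: phi_hom.
apply: ler_sum => t it.
have [s /andP[/eqP si st]|none] := pickP (fun s => (phi s == i) && E s t).
  rewrite (big_pred1 s) // => s' /=; apply/andP/eqP => [[/eqP s'i s't]|->].
    by apply: (phi_locinj (s := t)); rewrite ?[E t _]Esym // s'i.
  by rewrite si.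
by rewrite big_pred0 // v0.
Qed.

Lemma qform_push : 0 <= qform push.
Proof.
by apply: sumr_ge0 => i _; rewrite mulr_ge0 ?push_ge0 // subr_ge0 push_sub.
Qed.

End Pushforward.
(* The extended Dynkin diagram E8~: vertex 0 carries the arms 1-2-3-4-5, 6-7
   and 8, and [e8_weight] is its null root. *)
Definition e8_adj : rel 'I_9 := fun s t =>
  (t : nat) \in nth [::] [:: [:: 1; 6; 8]; [:: 0; 2]; [:: 1; 3]; [:: 2; 4];
    [:: 3; 5]; [:: 4]; [:: 0; 7]; [:: 6]; [:: 0]]%N s.

Definition e8_weight (s : 'I_9) : R :=
  (nth 0%N [:: 6; 5; 4; 3; 2; 1; 4; 2; 3]%N s)%:R.

Ltac ord9_cases s :=
  let m := fresh "m" in let lt9 := fresh "lt9" in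
  move: (nat_of_ord s) (ltn_ord s) => m lt9;
  destruct m as [|[|[|[|[|[|[|[|[|m]]]]]]]]];
  try discriminate lt9; clear lt9.

(** The inequalities are exactly local injectivity at the nine vertices of E8~, whose images may
    otherwise coincide. The null root is then pushed forward. *)
Lemma exists_e8 u p1 p2 p3 p4 p5 e1 e2 g :
  [&& G u p1, G p1 p2, G p2 p3, G p3 p4, G p4 p5, G u e1, G e1 e2 & G u g] ->
  [&& u != p2, p1 != p3, p2 != p4, p3 != p5, u != e2, p1 != e1, p1 != g
    & e1 != g] ->
  exists2 f, forall i, 0 <= f i &
    [/\ 0 <= qform f, (#|psupp f| <= 9)%N & u \in psupp f].
Proof.
case/and5P=> up1 p12 p23 p34 /and4P[p45 ue1 e12 ug].
case/and5P=> up2 p13 p24 p35 /and4P[ue2 pe pg eg].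
pose phi (s : 'I_9) := nth u [:: u; p1; p2; p3; p4; p5; e1; e2; g] s.
have Esym : symmetric e8_adj.
  by move=> s t; rewrite /e8_adj; ord9_cases s; ord9_cases t.
have v0 s : 0 <= e8_weight s by exact: ler0n.
have hom s t : e8_adj s t -> G (phi s) (phi t).
  rewrite /e8_adj /phi; ord9_cases s; ord9_cases t => //= _; by rewrite // Gsym.
have inj s t t' : e8_adj s t -> e8_adj s t' -> phi t = phi t' -> t = t'.
  move=> st st' tt; apply: val_inj; move: st st' tt; rewrite /e8_adj /phi /=.
  ord9_cases s; ord9_cases t => //= _; ord9_cases t' => //= _ h; exfalso;
  move: h => /eqP; apply/negP => //; by rewrite eq_sym.
have sub s : 2 * e8_weight s <= \sum_(t | e8_adj s t) e8_weight t.
  rewrite big_mkcond !big_ord_recr big_ord0 /e8_adj /e8_weight /=.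
  by ord9_cases s => /=; rewrite ?add0r ?addr0 -?natrD -?natrM ler_nat.
exists (push phi e8_weight); first by move=> i; exact: push_ge0.
split; first exact: (qform_push Esym).
  by rewrite (leq_trans (card_psupp_push _ _)) // card_ord.
by rewrite inE gt_eqF // -[u]/(phi ord0) push_gt0 // ltr0n.
Qed.

(** * Graphs of degree at most 4 without small positive vectors *)

Section Spread.

Hypothesis deg4 : forall i, (degree i <= 4)%N.
Hypothesis no_small : forall v, (forall i, 0 <= v i) ->
  (#|nbhd (psupp v)| <= 91)%N -> qform v <= 0.

(** An edge leaving the support would yield, by [qform_extend], a positive vector on at most 18
    vertices, whose closed neighbourhood has at most 18 * 5 = 90. *)
Lemma psupp_closed f : (forall i, 0 <= f i) -> 0 <= qform f ->
  (#|psupp f| <= 17)%N -> gclosed (psupp f).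
Proof.
move=> f0 qf fc i j iF ij; apply/negPn/negP => jF.
have [v v0 [qv sv]] := qform_extend f0 qf iF jF ij.
have : (#|nbhd (psupp v)| <= 91)%N.
  apply: leq_trans (card_nbhd _ deg4) _.
  have := subset_leq_card sv; rewrite cardsU1 jF.
  by lia.
by move=> /(no_small v0); rewrite leNgt qv.
Qed.

(** The star with weight 2 at its centre is the null root of D4~; its support must be closed. *)
Lemma card_component_deg4 i : degree i = 4 -> (#|component i| <= 5)%N.
Proof.
move=> di; have ss := psupp_star i 2.
have sc : (#|psupp (star i 2)| <= 5)%N.
  rewrite (leq_trans (subset_leq_card ss)) // cardsU1 !inE Girr /=.
  by rewrite [X in (_ + X <= _)%N]di.
have cl : gclosed (psupp (star i 2)).
  apply: psupp_closed; last by rewrite (leq_trans sc).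
    by move=> k; rewrite /star; case: eqP => // _; rewrite ler0n.
  by have := qform_star i (ler0n R 2); rewrite di; lra.
rewrite (leq_trans (subset_leq_card (component_sub cl _))) //.
by rewrite inE /star eqxx pnatr_eq0.
Qed.

(* A nonbacktracking walk of length 5 from [u] extends to an E8~ diagram, whose
   support must then be closed; without one the ball of radius 4 is closed, and
   it has at most 1 + 3 + 6 + 12 + 24 = 46 vertices. *)
Lemma card_component_deg3 u b c : degree u = 3 -> G u b -> G u c -> b != c ->
  (1 < degree b)%N -> (1 < degree c)%N -> (#|component u| <= 46)%N.
Proof.
move=> du ub uc bc db dc; rewrite leqNgt; apply/negP => big.
have deg3 i : i \in component u -> (degree i <= 3)%N.
  move=> iu; have := deg4 i; rewrite leq_eqVlt => /orP[/eqP/card_component_deg4|//].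
  by rewrite (component_eq iu) => h; lia.
pose B k := iter k nbhd [set u].
have BC k : B k \subset component u.
  elim: k => [|k IH]; first by rewrite sub1set component_id.
  by rewrite -(nbhd_closed (@component_closed u)); exact: nbhdS.
have Bmon k : B k \subset B k.+1 by exact: sub_nbhd.
have sphere k : (#|B k.+1 :\: B k| <= 3 * 2 ^ k)%N.
  elim: k => [|k IH].
    rewrite (leq_trans _ (eq_leq du)) //; apply/subset_leq_card/subsetP => i.
    rewrite in_setD [i \in [set j | _]]inE => /andP[iu /nbhdP[iB|[j]]].
      by rewrite iB in iu.
    by rewrite inE => /eqP->.
  rewrite expnSr mulnA; apply: leq_trans (leq_mul IH (leqnn 2)).
  by apply: card_next_sphere => i iB; apply: deg3; exact: (subsetP (BC k.+1)).
have ball k : #|B k.+1| = (#|B k.+1 :\: B k| + #|B k|)%N.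
  by rewrite -(cardsID (B k) (B k.+1)) (setIidPr (Bmon k)) addnC.
have B4 : (#|B 4%N| <= 46)%N.
  have B0 : #|B 0%N| = 1%N by exact: cards1.
  have := sphere 0; have := sphere 1; have := sphere 2; have := sphere 3.
  rewrite !ball B0 /=; lia.
have /subsetPn[p5 p5B5 p5B4] : ~~ (B 5%N \subset B 4%N).
  apply/negP => B54; have cl : gclosed (B 4%N).
    by move=> i j iB ij; apply: (subsetP B54); exact: mem_nbhd ij.
  have uB : u \in B 4%N.
    by do 4!apply: (subsetP (sub_nbhd _)); rewrite inE.
  by have := leq_trans (leq_trans big (subset_leq_card (component_sub cl uB))) B4.
(* A vertex at distance k + 2 from [u] has a neighbour at distance k + 1; descending from [p5]
   produces the walk. *)
have pred k p : p \in B k.+2 -> p \notin B k.+1 ->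
    exists2 p', G p' p & (p' \in B k.+1) && (p' \notin B k).
  move=> /nbhdP[pB /negP//|[p' p'B p'p] pB]; exists p' => //.
  by rewrite p'B; apply: contra pB => p'k; exact: mem_nbhd p'p.
have [p4 p45 /andP[p4B p4n]] := pred _ _ p5B5 p5B4.
have [p3 p34 /andP[p3B p3n]] := pred _ _ p4B p4n.
have [p2 p23 /andP[p2B p2n]] := pred _ _ p3B p3n.
have [p1 p12 /andP[p1B p1n]] := pred _ _ p2B p2n.
have up1 : G u p1.
  by case/nbhdP: p1B => [/(negP p1n)//|[j]]; rewrite inE => /eqP->.
have neq k p p' : p \in B k -> p' \notin B k.+1 -> p != p'.
  by move=> /(subsetP (Bmon k)) pk; apply: contraNneq => <-.
(* Of [b] and [c], one differs from [p1]; it starts the arm of length 2, and the third neighbour of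
   [u] is the arm [g]. *)
pose e1 := if p1 == b then c else b.
have [ue1 de1 pe] : [/\ G u e1, (1 < degree e1)%N & p1 != e1].
  by rewrite /e1; case: eqP => [->|/eqP]; split.
have [e2] : exists e2, e2 \in [set j | G e1 j] :\ u.
  apply/set0Pn; rewrite -card_gt0; move: de1.
  by rewrite /degree (cardsD1 u) inE Gsym ue1.
rewrite !inE => /andP[e2u e12].
have [g] : exists g, g \in [set j | G u j] :\ p1 :\ e1.
  have e1N : e1 \in [set j | G u j] :\ p1 by rewrite !inE eq_sym pe.
  have p1N : p1 \in [set j | G u j] by rewrite inE.
  apply/set0Pn; rewrite -card_gt0; move: du.
  by rewrite /degree (cardsD1 p1) (cardsD1 e1) p1N e1N !add1n => -[->].
rewrite !inE => /and3P[ge gp ug].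
have [||f f0 [qf fc fu]] := @exists_e8 u p1 p2 p3 p4 p5 e1 e2 g.
- by rewrite up1 p12 p23 p34 p45 ue1 e12 ug.
- rewrite pe (eq_sym p1 g) gp (eq_sym e1 g) ge (eq_sym u e2) e2u !andbT.
  have uB0 : u \in B 0%N by rewrite inE.
  rewrite (neq _ _ _ uB0 p2n) (neq _ _ _ p1B p3n) (neq _ _ _ p2B p4n).
  by rewrite (neq _ _ _ p3B p5B4).
have f17 : (#|psupp f| <= 17)%N by exact: leq_trans fc _.
have cl := psupp_closed f0 qf f17.
by have := leq_trans (leq_trans big (subset_leq_card (component_sub cl fu))) fc.
Qed.

(* On a component of more than 46 vertices, the function equal to 1/2 on leaves
   and to 1 elsewhere is superharmonic, as for the diagrams of type D and D~. *)
Lemma qform_le0 x : qform x <= 0.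
Proof.
apply: qform_components => u.
have [small|big] := leqP #|component u| 46.
  apply: le_trans (qform_norm _) _; apply: no_small => [i|]; first exact: normr_ge0.
  suff /nbhdS/subset_leq_card :
      psupp (fun i => `|restr (component u) x i|) \subset component u.
    by rewrite (nbhd_closed (@component_closed u)); lia.
  by apply/subsetP => i; rewrite inE normr_eq0 /restr; case: ifP => //; rewrite eqxx.
pose f i : R := if degree i == 1%N then 2^-1 else 1.
apply: (@qform_superharmonic f) => i.
  by rewrite /f; case: ifP; rewrite ?ltr01 // invr_gt0 ltr0n.
rewrite /restr; case: ifP => [iu _|_]; last by rewrite eqxx.
have f1 j : f j <= 1 by rewrite /f; case: ifP => // _; lra.
have le1 : nsum f i <= (degree i)%:R.
  by rewrite -[leRHS]mul1r -nsum_const; apply: ler_nsum.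
have ni : (degree i <= 3)%N.
  have := deg4 i; rewrite leq_eqVlt => /orP[/eqP/card_component_deg4|//].
  by rewrite (component_eq iu) => h; lia.
have [d3|d3] := eqVneq (degree i) 3; last first.
  have [d1|d1] := eqVneq (degree i) 1%N.
    by move: le1; rewrite /f d1 eqxx; lra.
  have : (degree i)%:R <= 2 :> R.
    rewrite ler_nat; lia.
  by rewrite [f i]/f (negPf d1); lra.
(* Two neighbours that are not leaves would bound the component by [card_component_deg3]. Two leaves
   of weight 1/2 bring the neighbour sum at [i] down to at most 2. *)
have leaves : (1 < #|[set j | G i j & degree j == 1%N]|)%N.
  rewrite ltnNge; apply/negP => few.
  pose N := [set j | G i j] :\: [set j | degree j == 1%N].
  have : (1 < #|N|)%N.
    have := cardsID [set j | degree j == 1%N] [set j | G i j].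
    have -> : [set j | G i j] :&: [set j | degree j == 1%N] =
        [set j | G i j & degree j == 1%N].
      by apply/setP => j; rewrite !inE.
    rewrite -/(degree i) d3 -/N; lia.
  case/card_gt1P => b [c]; rewrite !inE => -[] /andP[b1 ib] /andP[c1 ic] bc.
  have gt1 j : G i j -> degree j != 1%N -> (1 < degree j)%N.
    move=> ij; have : (0 < degree j)%N by apply/card_gt0P; exists i; rewrite inE Gsym.
    lia.
  have := card_component_deg3 d3 ib ic bc (gt1 _ ib b1) (gt1 _ ic c1).
  by rewrite (component_eq iu); lia.
have -> : nsum f i = (degree i)%:R - 2^-1 * #|[set j | G i j & degree j == 1%N]|%:R.
  rewrite -[(degree i)%:R]mul1r -nsum_const -sum1_card natr_sum mulr_sumr.
  rewrite (eq_bigl (fun j => G i j && (degree j == 1%N))); last by move=> j; rewrite inE.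
  rewrite big_mkcondr /nsum -sumrB; apply: eq_bigr => j _.
  by rewrite /f; case: ifP; rewrite ?subr0 //; lra.
rewrite /f d3 /= mulr1.
have : 2 <= #|[set j | G i j & degree j == 1%N]|%:R :> R by rewrite ler_nat.
lra.
Qed.

End Spread.

(** * The kernel when the form is nowhere positive *)

Section Semidefinite.

Hypothesis qle0 : forall x, qform x <= 0.

Lemma psupp_null_closed f : (forall i, 0 <= f i) -> 0 <= qform f ->
  gclosed (psupp f).
Proof.
move=> f0 qf i j iF ij; apply/negPn/negP => jF.
have [v _ [qv _]] := qform_extend f0 qf iF jF ij.
by have := qle0 v; rewrite leNgt qv.
Qed.

Lemma kernel_sum0 x : in_kernel x -> \sum_i x i = 0.
Proof.
move=> /qform_kernel qx; apply/eqP; rewrite -sqrf_eq0 eq_le sqr_ge0 andbT -qx.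
by have := qle0 x; lra.
Qed.

Lemma kernel_eigen x i : in_kernel x -> nsum x i = 2 * x i.
Proof. by move=> Kx; have := Kx i; rewrite (kernel_sum0 Kx); lra. Qed.

Lemma qform_norm_kernel x : in_kernel x -> 0 <= qform (fun i => `|x i|).
Proof.
move=> Kx; have := qform_norm x.
by rewrite (qform_eigen (fun i => kernel_eigen i Kx)).
Qed.

Lemma psupp_norm x : psupp (fun i => `|x i|) = psupp x.
Proof. by apply/setP => i; rewrite !inE normr_eq0. Qed.

Lemma psupp_kernel_closed x : in_kernel x -> gclosed (psupp x).
Proof.
move=> Kx; rewrite -psupp_norm; apply: psupp_null_closed => [i|].
  exact: normr_ge0.
exact: qform_norm_kernel.
Qed.

(** The form vanishes at the absolute value of [x], and by the triangle inequality all its terms are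
    nonnegative, so each is zero. Where [x i] is zero, closedness of the support makes [x] vanish on
    the neighbours too. *)
Lemma norm_eigen x i : in_kernel x -> nsum (fun i => `|x i|) i = 2 * `|x i|.
Proof.
move=> Kx; have [xi|xi] := eqVneq (x i) 0.
  rewrite xi normr0 mulr0; apply: big1 => j ij.
  have [->|xj] := eqVneq (x j) 0; first by rewrite normr0.
  have jS : j \in psupp x by rewrite inE.
  have := psupp_kernel_closed Kx (j := i) jS; rewrite Gsym => /(_ ij).
  by rewrite inE xi eqxx.
have term j : 0 <= `|x j| * (nsum (fun k => `|x k|) j - 2 * `|x j|).
  rewrite mulr_ge0 // subr_ge0 -[2]gtr0_norm // -normrM -(kernel_eigen j Kx).
  exact: ler_norm_sum.
have /eqP : qform (fun k => `|x k|) = 0.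
  by apply/eqP; rewrite eq_le qle0 qform_norm_kernel.
rewrite psumr_eq0 // => /allP/(_ i); rewrite mem_index_enum => /(_ isT) /=.
by rewrite mulf_eq0 normr_eq0 (negPf xi) subr_eq0 => /eqP.
Qed.

(** Where the absolute value is maximal on the component, the eigenvalue equation forces degree at
    least 2. *)
Lemma kernel_component_card x i : in_kernel x -> x i != 0 ->
  (3 <= #|component i|)%N.
Proof.
move=> Kx xi.
have [j ji jmax] := @arg_maxP _ _ _ i (fun j => j \in component i)
  (fun j => `|x j|) (component_id i).
have xj : 0 < `|x j|.
  by rewrite (lt_le_trans _ (jmax i (component_id i))) // normr_gt0.
have : 2 * `|x j| <= `|x j| * (degree j)%:R.
  rewrite -(norm_eigen j Kx) -nsum_const; apply: ler_nsum => k jk.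
  by apply: jmax; exact: component_closed ji jk.
rewrite [leRHS]mulrC ler_pM2r // (ler_nat R 2) => dj.
have : j |: [set k | G j k] \subset component i.
  apply/subsetP => k; rewrite !inE => /orP[/eqP->|]; first by move: ji; rewrite inE.
  by move=> jk; have := component_closed ji jk; rewrite inE.
move=> /subset_leq_card; apply: leq_trans.
by rewrite cardsU1 inE Girr ltnS.
Qed.

(** The sum of [x] and its absolute value is a nonnegative eigenvector, so its support, the set
    where [x] is positive, is closed. *)
Lemma kernel_component_gt0 x i j : in_kernel x -> 0 < x i ->
  j \in component i -> 0 < x j.
Proof.
move=> Kx xi ji; pose f k := `|x k| + x k.
have f0 k : 0 <= f k by have := ler_norm (- x k); rewrite normrN /f; lra.
have fe k : nsum f k = 2 * f k.
  by rewrite nsumD norm_eigen // kernel_eigen // /f; ring.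
have cl : gclosed (psupp f) by apply: psupp_null_closed; rewrite ?qform_eigen.
have fi : i \in psupp f by rewrite inE gt_eqF // /f ltr_pwDr // normr_ge0.
have := subsetP (component_sub cl fi) j ji; rewrite inE /f.
by case: (ler0P (x j)) => // _; rewrite addrC subrr eqxx.
Qed.

Lemma kernelN x : in_kernel x -> in_kernel (fun i => - x i).
Proof. by move=> Kx i; rewrite nsumN sumrN -(Kx i); ring. Qed.

(* A kernel vector is constant in sign on each component, and sums to zero; so
   it vanishes as soon as it does on all but one of the components. *)
Lemma kernel_unique_semidefinite : (3 <= #|T|)%N ->
  exists2 B : {set T}, (3 * #|B| + 3 <= #|T|)%N &
    forall x, in_kernel x -> (forall i, i \in B -> x i = 0) -> forall i, x i = 0.
Proof.
move=> T3; pose Z := [set r | (fingraph.root G r == r) && (3 <= #|component r|)%N].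
have Zcard : (3 * #|Z| <= #|T|)%N.
  rewrite mulnC -sum_nat_const.
  apply: (@leq_trans (\sum_(r in Z) #|component r|)%N).
    by apply: leq_sum => r; rewrite inE => /andP[].
  have -> : #|T| = (\sum_r \sum_(i | fingraph.root G i == r) 1)%N.
    by rewrite -sum1_card (partition_big (fingraph.root G) predT).
  rewrite big_mkcond; apply: leq_sum => r _; case: ifP => //.
  rewrite inE => /andP[/eqP rr _].
  rewrite -sum1_card (eq_bigl (fun i => fingraph.root G i == r)) // => i.
  by rewrite inE rr.
have rootZ x i : in_kernel x -> x i != 0 -> fingraph.root G i \in Z.
  move=> Kx /(kernel_component_card Kx) Ci.
  rewrite inE root_root; last exact: connect_G_sym.
  rewrite eqxx /= (@component_eq i) // inE root_root //; exact: connect_G_sym.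
have rootN x i : in_kernel x -> x i != 0 -> x (fingraph.root G i) != 0.
  move=> Kx xi; have iS : i \in psupp x by rewrite inE.
  have := subsetP (component_sub (psupp_kernel_closed Kx) iS) (fingraph.root G i).
  by rewrite !inE => -> //; rewrite root_root //; exact: connect_G_sym.
(* If no component has three vertices, the kernel is trivial; otherwise dropping [z] saves the
   summand 3. *)
have [Z0|[z zZ]] := set_0Vmem Z.
  exists set0 => [|x Kx _ i]; first by rewrite cards0.
  apply/eqP; apply: contraTT isT => /(rootZ _ _ Kx).
  by rewrite Z0 inE.
exists (Z :\ z) => [|x Kx x0 i]; first by move: Zcard; rewrite (cardsD1 z) zZ; lia.
have zroot j : x j != 0 -> fingraph.root G j = z.
  move=> xj; have := rootZ _ _ Kx xj; have := rootN _ _ Kx xj.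
  by move=> rj rZ; apply/eqP; apply: contraNT rj => rz; rewrite x0 // in_setD1 rz.
(* A positive value would make [y] nonnegative with positive sum; this is used for [x] and for its
   negative. *)
have onesign y : in_kernel y -> (forall j, y j != 0 -> fingraph.root G j = z) -> y i <= 0.
  move=> Ky yz; rewrite leNgt; apply/negP => yi.
  have y0 j : 0 <= y j.
    have [->//|yj] := eqVneq (y j) 0; apply/ltW/(kernel_component_gt0 Ky yi).
    by rewrite inE !yz // gt_eqF.
  have := kernel_sum0 Ky => /eqP; rewrite psumr_eq0 // => /allP/(_ i).
  by rewrite mem_index_enum => /(_ isT) /=; rewrite gt_eqF.
apply/eqP; rewrite eq_le onesign //= -oppr_le0.
apply: (onesign (fun j => - x j)); first exact: kernelN.
by move=> j; rewrite oppr_eq0; exact: zroot.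
Qed.

End Semidefinite.

Theorem kernel_determining_set : (forall x, 2 * qform x <= (\sum_i x i) ^+ 2) ->
  (forall i, degree i <= 16)%N -> (277 <= #|T|)%N ->
  exists2 B : {set T}, (3 * #|B| + 3 <= #|T|)%N &
    forall x, in_kernel x -> (forall i, i \in B -> x i = 0) -> forall i, x i = 0.
Proof.
move=> psd d16 T277.
have d4 i : (degree i <= 4)%N.
  rewrite leqNgt; apply/negP => d5; have := degree_large_bound psd d16 d5; lia.
(* 91 is the largest c with 3c + 3 at most 277. *)
have [[v qv vc]|nosmall] :=
    pselect (exists2 v, 0 < qform v & (#|nbhd (psupp v)| <= 91)%N).
  exists (nbhd (psupp v)); first by lia.
  by move=> x; exact: kernel_unique.
apply: kernel_unique_semidefinite; last by lia.
apply: qform_le0 => // v _ vc; rewrite leNgt; apply/negP => qv.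
by apply: nosmall; exists v.
Qed.

End GraphForm.

(** * From Seidel matrices to graphs and back *)

Lemma switch_mxK (R : realType) (n : nat) (U : {set 'I_n}) :
  switch_mx R U *m switch_mx R U = 1%:M.
Proof.
apply/matrixP => i j; rewrite mul_diag_mx !mxE.
by case: (i == j); case: (i \in U); rewrite ?mulr1n ?mulr0n; ring.
Qed.

Lemma switch_mx_tr (R : realType) (n : nat) (U : {set 'I_n}) :
  (switch_mx R U)^T = switch_mx R U.
Proof. exact: tr_diag_mx. Qed.

Lemma seidel_entry (R : realType) (n : nat) (S : 'M[R]_n) i j : is_seidel S ->
  (S + 5%:M) i j = 1 + 4 * (i == j)%:R - 2 * (seidel_graph S i j)%:R.
Proof.
case=> _ S0 S1; rewrite !mxE /seidel_graph.
have [<-|ij] := eqVneq i j; first by rewrite S0 eq_sym oppr_eq0 oner_eq0 /=; ring.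
have N11 : (1 == -1 :> R) = false by rewrite gt_eqF //; lra.
by case: (S1 _ _ ij) => ->; rewrite ?N11 ?eqxx /=; ring.
Qed.

Lemma mulmx_seidel (R : realType) (n : nat) (S : 'M[R]_n) (x : 'rV[R]_n) j :
  is_seidel S -> (x *m (S + 5%:M)) 0 j =
    \sum_i x 0 i - 2 * (nsum (seidel_graph S) (x 0) j - 2 * x 0 j).
Proof.
move=> hS; rewrite mxE.
rewrite (eq_bigr (fun i => x 0 i + (4 * (x 0 i * (i == j)%:R)
    - 2 * (x 0 i * (seidel_graph S j i)%:R)))); last first.
  by move=> i _; rewrite (seidel_entry _ _ hS) (seidel_graph_sym hS i j); ring.
rewrite big_split sumrB -!mulr_sumr /=.
have -> : \sum_i x 0 i * (i == j)%:R = x 0 j.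
  rewrite (bigD1 j) //= eqxx mulr1 big1 ?addr0 // => i /negPf->.
  by rewrite mulr0.
have -> : \sum_i x 0 i * (seidel_graph S j i)%:R = nsum (seidel_graph S) (x 0) j.
  rewrite /nsum [RHS]big_mkcond; apply: eq_bigr => i _.
  by case: seidel_graph; rewrite ?mulr1 ?mulr0.
ring.
Qed.

Theorem theorem5p3 (R : realType) (n : nat) (S : 'M[R]_n)
    (hn : (277 <= n)%N)
    (hS : is_seidel S)
    (hmin : is_lambda_min S (-5))
    (hG : exists2 G : rel 'I_n,
        switching_class S G & (max_valency G <= 16)%N) :
  2 * n%:R / 3 + 1 <= (\rank (S + 5%:M)%R)%:R :> R.
Proof.
case: hG => G [U GE] valG; set S' := switching U S in GE.
have hS' : is_seidel S' := switching_seidel U hS.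
set D := switch_mx R U.
have DD : D *m D = 1%:M := switch_mxK R U.
have St : S^T = S by case: hS.
(* The Rayleigh bound for [S] at [y *m D] is the bound for the switched matrix at [y], since [D] is
   an involution. *)
have psd (x : 'I_n -> R) : 2 * qform (seidel_graph S') x <= (\sum_i x i) ^+ 2.
  pose y : 'rV[R]_n := \row_i x i.
  have yx : y 0 = x by apply: funext => i; rewrite mxE.
  have := symmetric_rayleigh St hmin.2 (y *m D).
  have -> : y *m D *m S *m (y *m D)^T = y *m (S' + 5%:M) *m y^T - 5 *: (y *m y^T).
    rewrite trmx_mul switch_mx_tr mulmxDr mulmxDl mul_mx_scalar -scalemxAl addrK.
    by rewrite /S' /switching !mulmxA.
  have -> : y *m D *m (y *m D)^T = y *m y^T.
    by rewrite trmx_mul switch_mx_tr mulmxA -(mulmxA y) DD mulmx1.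
  have -> : (y *m (S' + 5%:M) *m y^T - 5 *: (y *m y^T)) 0 0 =
      (\sum_i x i) ^+ 2 - 2 * qform (seidel_graph S') x - 5 * (y *m y^T) 0 0.
    have entry (A B : 'M[R]_1) : (A - 5 *: B) 0 0 = A 0 0 - 5 * B 0 0 by rewrite !mxE.
    rewrite entry; congr (_ - _).
    rewrite mxE /qform /pform expr2 {1}mulr_suml mulr_sumr -sumrB.
    by apply: eq_bigr => i _; rewrite mulmx_seidel // [y^T i 0]mxE yx; ring.
  lra.
have sym := seidel_graph_sym hS'; have irr := seidel_graph_irr hS'.
have deg i : (degree (seidel_graph S') i <= 16)%N.
  rewrite (leq_trans _ valG) // (leq_trans _ (leq_bigmax i)) //.
  by rewrite /valency /degree eq_leq //; apply: eq_card => j; rewrite !inE GE.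
have [|B Bc BK] := kernel_determining_set sym irr psd deg; first by rewrite card_ord.
rewrite card_ord in Bc.
(* Multiplication by [D] maps the kernel of S + 5 I to that of the switched matrix and only changes
   signs, so zeros on [B] are preserved. *)
have rk : (n <= \rank (S + 5%:M)%R + #|B|)%N.
  apply: rank_complement_bound => x xS x0.
  have yS' : x *m D *m (S' + 5%:M) = 0.
    rewrite /S' /switching mulmxDr mul_mx_scalar !mulmxA -(mulmxA x) DD mulmx1.
    by rewrite scalemxAl -mulmxDl -mul_mx_scalar -mulmxDr xS mul0mx.
  have yE i : (x *m D) 0 i = x 0 i * (if i \in U then 1 else -1).
    by rewrite mul_mx_diag !mxE.
  have y0 i : (x *m D) 0 i = 0.
    apply: BK i => [i|i iB]; last by rewrite yE x0 ?mul0r.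
    have := mulmx_seidel (x *m D) i hS'; rewrite yS' mxE; lra.
  rewrite -[x]mulmx1 -DD mulmxA; have -> : x *m D = 0 by apply/rowP => i; rewrite y0 mxE.
  by rewrite mul0mx.
have : (2 * n + 3 <= 3 * \rank (S + 5%:M)%R)%N by lia.
rewrite -(ler_nat R) natrD !natrM; lra.
Qed.
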